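(* Let $V_1,V_2\in C(\mathbb{T}^n)$ and $H_i(\xi,p)=|p|^2-V_i(\xi)$ for $i=1,2$. Assume that $V_i\ge0$ in $\mathbb{T}^n$ for $i=1,2$ and $$\{V_1=0\}=\{V_2=0\}=\{\xi=(\xi_1,\dots,\xi_n)\in\mathbb{T}^n:\ \xi_j=1/2\ \text{for } j\ge2\}.$$ Then the following hold. (i) There exists $\gamma>0$ such that $\overline{H}(P)=|P_1|^2$ for every $P=(P_1,P')\in\mathbb{R}\times\mathbb{R}^{n-1}$ with $|P'|\le\gamma$. (ii) $\overline{H}(P)\ge|P_1|^2$ for all $P=(P_1,P')\in\mathbb{R}\times\mathbb{R}^{n-1}$.
   Context: $\mathbb{T}^n=\mathbb{R}^n/\mathbb{Z}^n$ is identified with $[0,1]^n$ (opposite faces glued), and functions on $\mathbb{T}^n$ are identified with $\mathbb{Z}^n$-periodic functions on $\mathbb{R}^n$. Effective Hamiltonian: for each $P\in\mathbb{R}^n$ it is known that there is a unique constant $\overline{H}(P)$ such that the cell problem $$H_1(\xi,P+Dv_1(\xi))+v_1(\xi)-v_2(\xi)=\overline{H}(P),\qquad H_2(\xi,P+Dv_2(\xi))+v_2(\xi)-v_1(\xi)=\overline{H}(P)\quad\text{in }\mathbb{T}^n$$ admits a continuous viscosity solution $(v_1,v_2)\in C(\mathbb{T}^n)^2$ (viscosity inequalities are imposed on each component with the other component inserted as a given function). *)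

(* Defs.v *)
From HB Require Import structures.
From mathcomp Require Import all_boot all_order all_algebra.
From mathcomp Require Import all_classical all_reals all_analysis.

Set Implicit Arguments.
Unset Strict Implicit.
Unset Printing Implicit Defensive.

Import Order.TTheory GRing.Theory Num.Theory.
Import numFieldNormedType.Exports.

Local Open Scope classical_set_scope.
Local Open Scope ring_scope.

(* Euclidean norm: the library's norm `|p| on row vectors is the sup norm
   (it induces the same topology). *)
Definition enorm (R : realType) (n : nat) (p : 'rV[R]_n) : R :=
  Num.sqrt (\sum_(j < n) p 0 j ^+ 2).

(* The dimension is written n.+1 (the torus has dimension at least 1); index
   ord0 is the first coordinate.  Functions on the torus are Z^(n+1)-periodic
   functions on R^(n+1). *)
Definition Zperiodic (R : realType) (n : nat) (f : 'rV[R]_n.+1 -> R) : Prop :=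
  forall (x : 'rV[R]_n.+1) (z : 'rV[int]_n.+1),
    f (x + map_mx (fun k : int => k%:~R) z) = f x.

Definition torus_continuous (R : realType) (n : nat)
    (f : 'rV[R]_n.+1 -> R) : Prop :=
  Zperiodic f /\ continuous f.

(* The cube [0,1]^(n+1), which covers the torus. *)
Definition unit_cube (R : realType) (n : nat) : set 'rV[R]_n.+1 :=
  [set x | forall j, 0 <= x 0 j <= 1].

Definition grad (R : realType) (n : nat) (f : 'rV[R]_n.+1 -> R)
    (x : 'rV[R]_n.+1) : 'rV[R]_n.+1 :=
  \row_j 'D_(delta_mx 0 j) f x.

Definition C1 (R : realType) (n : nat) (f : 'rV[R]_n.+1 -> R) : Prop :=
  (forall x, differentiable f x) /\ continuous (grad f).

(* Viscosity sub- and supersolutions of the scalar equation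
   F(x, u(x), Du(x)) = 0. *)
Definition viscosity_subsolution (R : realType) (n : nat)
    (F : 'rV[R]_n.+1 -> R -> 'rV[R]_n.+1 -> R) (u : 'rV[R]_n.+1 -> R) : Prop :=
  forall (phi : 'rV[R]_n.+1 -> R) (x : 'rV[R]_n.+1), C1 phi ->
    (\forall y \near x, u y - phi y <= u x - phi x) ->
    F x (u x) (grad phi x) <= 0.

Definition viscosity_supersolution (R : realType) (n : nat)
    (F : 'rV[R]_n.+1 -> R -> 'rV[R]_n.+1 -> R) (u : 'rV[R]_n.+1 -> R) : Prop :=
  forall (phi : 'rV[R]_n.+1 -> R) (x : 'rV[R]_n.+1), C1 phi ->
    (\forall y \near x, u x - phi x <= u y - phi y) ->
    0 <= F x (u x) (grad phi x).

Definition viscosity_solution (R : realType) (n : nat)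
    (F : 'rV[R]_n.+1 -> R -> 'rV[R]_n.+1 -> R) (u : 'rV[R]_n.+1 -> R) : Prop :=
  viscosity_subsolution F u /\ viscosity_supersolution F u.

(* (v1, v2) is a continuous viscosity solution on the torus of
     H1(x, P + Dv1) + v1 - v2 = c,   H2(x, P + Dv2) + v2 - v1 = c. *)
Definition cell_solution (R : realType) (n : nat)
    (H1 H2 : 'rV[R]_n.+1 -> 'rV[R]_n.+1 -> R) (P : 'rV[R]_n.+1) (c : R)
    (v1 v2 : 'rV[R]_n.+1 -> R) : Prop :=
  [/\ torus_continuous v1,
      torus_continuous v2,
      viscosity_solution (fun x r p => H1 x (P + p) + r - v2 x - c) v1
    & viscosity_solution (fun x r p => H2 x (P + p) + r - v1 x - c) v2].

(* Solvability of the cell problem is what ties Hbar P to H1, H2.  The constant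
   is known to be unique, so this determines Hbar; uniqueness itself is not
   made part of the hypothesis. *)
Definition is_effective_hamiltonian (R : realType) (n : nat)
    (H1 H2 : 'rV[R]_n.+1 -> 'rV[R]_n.+1 -> R) (Hbar : 'rV[R]_n.+1 -> R) : Prop :=
  forall P, exists v1 v2, cell_solution H1 H2 P (Hbar P) v1 v2.

Definition quad_hamiltonian (R : realType) (n : nat) (V : 'rV[R]_n.+1 -> R)
    (x p : 'rV[R]_n.+1) : R :=
  enorm p ^+ 2 - V x.

(* For P = (P_1, P'), the component P' in R^n. *)
Definition tail (R : realType) (n : nat) (P : 'rV[R]_n.+1) : 'rV[R]_n :=
  col' ord0 P.

(* Main.v *)
(* Write c = Hbar(P) and V_i = 0 on the line x' = 1/2.
   Lower bound: at a maximum point of max(v1, v2) - K |x' - 1/2|^2, realised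
   by v_i, the coupling term v_i - v_j is nonnegative and the penalty has no
   first derivative in x_1, so the subsolution test gives
   P_1^2 <= c + V_i(x); as K grows, x approaches the line and V_i(x) -> 0.
   Upper bound: take S(x) = sum_(j >= 2) S_j(x_j) with DS = P' exactly in a
   neighbourhood of the line and |P' - DS| <= 8 |P'| everywhere in the cube.
   At a minimum point of min(v1, v2) + S, realised by v_i, the coupling term
   is nonpositive and the supersolution test with -S gives
   c <= P_1^2 + |P' - DS|^2 - V_i(x).  The last two terms are nonpositive for
   small P', because V_i is bounded below away from the line. *)
Require Import Defs.
From mathcomp Require Import all_boot all_order all_algebra.
From mathcomp Require Import all_classical all_reals all_analysis.
From mathcomp Require Import ring lra.
Set Implicit Arguments.
Unset Strict Implicit.
Unset Printing Implicit Defensive.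
Import Order.TTheory GRing.Theory Num.Theory.
Import numFieldNormedType.Exports.
Local Open Scope classical_set_scope.
Local Open Scope ring_scope.

(** * Smooth test functions that are sums over the coordinates *)

(** The remainder bound keeps the difference quotient within [C * |h|] of [d]. This differentiates
    piecewise quadratic functions without separate limits at their kinks. *)
Lemma is_derive_quadratic_remainder (R : realType) (f : R -> R) (x d C : R) :
  (forall h, `|f (h + x) - f x - d * h| <= C * h ^+ 2) -> is_derive x 1 f d.
Proof.
move=> fC.
suff lim_d : h^-1 *: ((f \o shift x) (h *: (1 : R)) - f x) @[h --> 0^'] --> d.
  by apply: DeriveDef; [apply/cvg_ex; exists d|exact/cvg_lim].
have C0 : 0 <= C.
  by have := le_trans (normr_ge0 _) (fC 1); rewrite expr1n mulr1.
have C1_gt0 : 0 < C + 1 by rewrite ltr_wpDl.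
apply/cvgrPdist_le => e e0; near=> h.
have h0 : h != 0 by near: h; exact: nbhs_dnbhs_neq.
rewrite /= /GRing.scale /= mulr1 distrC.
have -> : h^-1 * (f (h + x) - f x) - d = h^-1 * (f (h + x) - f x - d * h).
  by field.
rewrite normrM normfV ler_pdivrMl ?normr_gt0//.
apply: (le_trans (fC h)); rewrite -[h ^+ 2]real_normK ?num_real// expr2 mulrCA.
rewrite ler_wpM2l//; apply: (@le_trans _ _ ((C + 1) * `|h|)).
  by rewrite ler_wpM2r// lerDl.
rewrite mulrC -ler_pdivlMr//; near: h.
by apply: dnbhs0_le; rewrite divr_gt0.
Unshelve. all: by end_near. Qed.

Lemma continuous_row (R : realType) (T : topologicalType) (n : nat)
    (f : T -> 'rV[R]_n) :
  (forall j, continuous (fun x => f x 0 j)) -> continuous f.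
Proof.
move=> fc x; apply/cvg_ballP => e e0.
have : \forall y \near x, forall j, ball (f x 0 j) e (f y 0 j).
  by apply: filter_forall => j; have /cvg_ballP := fc j x; exact.
apply: filterS => y fxy; split => // i j; rewrite (ord1 i); exact: fxy.
Qed.

(** Only the i-th summand varies in direction i, so each partial derivative is a one-variable
    derivative. The penalties of both bounds have this form. *)
Lemma C1_separable (R : realType) (n : nat) (F F' : 'I_n.+1 -> R -> R) :
  (forall j (t : R), is_derive t 1 (F j) (F' j t)) ->
  (forall j, continuous (F' j)) ->
  let S := fun x : 'rV[R]_n.+1 => \sum_j F j (x 0 j) in
  C1 S /\ forall x, grad S x = \row_j F' j (x 0 j).
Proof.
move=> FF' cF' S.
have SE : S = \sum_(j < n.+1) (fun x : 'rV[R]_n.+1 => F j (x 0 j)).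
  by apply/funext => x; rewrite fct_sumE.
have dF (x : 'rV[R]_n.+1) j :
    differentiable (fun x : 'rV[R]_n.+1 => F j (x 0 j)) x.
  apply: (@differentiable_comp _ _ _ _ (fun x : 'rV[R]_n.+1 => x 0 j) (F j)).
    exact: differentiable_coord.
  by apply/derivable1_diffP; have [] := FF' j (x 0 j).
have gradS x : grad S x = \row_j F' j (x 0 j).
  apply/rowP => i; rewrite !mxE SE derive_sum; last first.
    by move=> j; exact: diff_derivable.
  rewrite (bigD1 i)//= big1 ?addr0 => [|j ji].
    rewrite -(@derive_val _ _ _ _ _ _ _ (FF' i (x 0 i))) /derive.
    apply: (congr1 (fun g : R -> R => lim (g @ 0^'))); apply/funext => h /=.
    by rewrite !mxE !eqxx.
  rewrite /derive.
  suff -> : (fun h : R => h^-1 *: (((fun x : 'rV[R]_n.+1 => F j (x 0 j)) \o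
      shift x) (h *: delta_mx 0 i) - F j (x 0 j))) = cst 0 by exact: lim_cst.
  apply/funext => h /=.
  by rewrite !mxE (negbTE ji) mulr0 add0r subrr scaler0.
split=> //; split; first by move=> x; rewrite SE; exact: differentiable_sum.
apply: continuous_row => j.
rewrite (_ : (fun _ => _) = F' j \o (fun x : 'rV[R]_n.+1 => x 0 j)).
  move=> x; apply: continuous_comp; first exact: coord_continuous.
  exact: cF'.
by apply/funext => x; rewrite gradS mxE.
Qed.

(** * Compactness of the cube and attained extrema *)

Lemma compact_unit_cube (R : realType) (n : nat) :
  compact (@unit_cube R n).
Proof.
have := @rV_compact R n.+1 (fun=> `[0, 1]%classic) (fun=> @segment_compact R 0 1).
congr compact; apply/seteqP; split => x /= xP j; have := xP j;
  by rewrite in_itv.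
Qed.

Lemma unit_cube_translate (R : realType) (n : nat) (x : 'rV[R]_n.+1) :
  exists z : 'rV[int]_n.+1, unit_cube (x + map_mx (fun k : int => k%:~R) z).
Proof.
exists (\row_j - Num.floor (x 0 j)) => j; rewrite !mxE intrN.
have := Num.Theory.floor_itv (x 0 j); rewrite intrD; lra.
Qed.

(* The growth condition on [F] replaces periodicity: translating a point back
   into the unit cube decreases the separable penalty, so a minimum over the
   cube is a global one. *)
Lemma penalized_min_attained (R : realType) (n : nat)
    (u1 u2 : 'rV[R]_n.+1 -> R) (F : 'I_n.+1 -> R -> R) :
  torus_continuous u1 -> torus_continuous u2 ->
  (forall j, continuous (F j)) ->
  (forall j t (m : int), 0 <= t <= 1 -> F j t <= F j (t + m%:~R)) ->
  let S := fun x : 'rV[R]_n.+1 => \sum_j F j (x 0 j) in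
  exists2 x, unit_cube x &
    (u1 x <= u2 x /\ forall y, u1 x + S x <= u1 y + S y) \/
    (u2 x <= u1 x /\ forall y, u2 x + S x <= u2 y + S y).
Proof.
move=> [u1_per u1_cont] [u2_per u2_cont] F_cont F_grow S.
have S_cont : continuous S.
  apply: continuous_big => [|j _ x]; first exact: add_continuous.
  by apply: continuous_comp; [exact: coord_continuous|exact: F_cont].
pose m x := Num.min (u1 x) (u2 x) + S x.
have m_cont : continuous m.
  move=> x; apply: (@continuousD _ _ _ (u1 \min u2) S); last exact: S_cont.
  by apply: continuous_min; [exact: u1_cont|exact: u2_cont].
have [||x] := @compact_EVT_min _ R m _ _ (@compact_unit_cube R n).
- by exists (const_mx 0) => j; rewrite mxE lexx ler01.
- exact: continuous_subspaceT.
rewrite inE => x_cube x_min; exists x => //.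
have m_min y : m x <= m y.
  have [z yz_cube] := unit_cube_translate y.
  apply: le_trans (x_min _ (mem_set yz_cube)) _.
  rewrite /m u1_per u2_per lerD2l; apply: ler_sum => j _.
  have := F_grow j _ (- z 0 j) (yz_cube j).
  by rewrite !mxE intrN addrK.
have m_le y : m y <= u1 y + S y /\ m y <= u2 y + S y.
  by rewrite /m !lerD2r !ge_min !lexx orbT.
(* The component that realises the minimum at [x] inherits global minimality, since [m] lies below
   both penalised components. *)
have [u12|/ltW u21] := leP (u1 x) (u2 x); [left|right]; split => // y.
  have [m_le1 _] := m_le y.
  by apply: le_trans m_le1; rewrite -(min_idPl u12) m_min.
have [_ m_le2] := m_le y.
by apply: le_trans m_le2; rewrite -(min_idPr u21) m_min.
Qed.

(** Take for [d] the minimum of [f] on the compact part of [A] where [e <= g]; it is positive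
    because [f] cannot vanish there. The lower bound uses it with [f] the distance to the line and
    [g] a potential, the upper bound with the roles exchanged. *)
Lemma compact_separation (R : realType) (T : topologicalType) (A : set T)
    (f g : T -> R) (e : R) :
  compact A -> continuous f -> continuous g -> 0 < e ->
  (forall x, A x -> 0 <= f x) -> (forall x, A x -> f x = 0 -> g x = 0) ->
  exists2 d, 0 < d & forall x, A x -> f x < d -> g x < e.
Proof.
move=> A_compact f_cont g_cont e_gt0 f_ge0 fg0.
pose B := A `&` [set x | e <= g x].
have B_compact : compact B.
  apply: compact_closedI => //.
  rewrite (_ : [set x | e <= g x] = g @^-1` [set t | e <= t])//.
  by apply: closed_comp; [move=> x _; exact: g_cont|exact: closed_ge].
have [B_nonempty|/set0P/negP/negPn/eqP B0] := pselect (B !=set0); last first.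
  exists 1 => // x Ax _; rewrite ltNge; apply/negP => gx.
  by have : B x by []; rewrite B0.
have [|c] := @compact_EVT_min _ R f _ B_nonempty B_compact.
  exact: continuous_subspaceT.
rewrite inE => -[Ac gc] c_min; exists (f c).
  rewrite lt_neqAle f_ge0// andbT eq_sym; apply/eqP => fc0.
  by have := lt_le_trans e_gt0 gc; rewrite (fg0 _ Ac fc0) ltxx.
move=> x Ax; apply: contraTT; rewrite -!leNgt => gx.
by apply: c_min; rewrite inE.
Qed.

Lemma unit_cube_bounded (R : realType) (n : nat) (u : 'rV[R]_n.+1 -> R) :
  continuous u -> exists M : R, forall x, unit_cube x -> `|u x| <= M.
Proof.
move=> u_cont.
have [||c _ c_max] := @compact_EVT_max _ R (fun x => `|u x|) _ _
  (@compact_unit_cube R n).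
- by exists (const_mx 0) => j; rewrite mxE lexx ler01.
- apply: continuous_subspaceT => x.
  by apply: continuous_comp; [exact: u_cont|exact: norm_continuous].
by exists `|u c| => x x_cube; apply: c_max; rewrite inE.
Qed.

(** * Viscosity tests with a signed coupling term, and the Euclidean norm *)

Section test_functions.
Variables (R : realType) (n : nat) (V u w : 'rV[R]_n.+1 -> R).
Variables (P x : 'rV[R]_n.+1) (c : R) (phi : 'rV[R]_n.+1 -> R).

Lemma subsolution_test :
  viscosity_subsolution
    (fun x r p => quad_hamiltonian V x (P + p) + r - w x - c) u ->
  C1 phi -> w x <= u x -> (forall y, u y - phi y <= u x - phi x) ->
  enorm (P + grad phi x) ^+ 2 <= c + V x.
Proof.
move=> u_sub phiC1 wu x_max.
have : enorm (P + grad phi x) ^+ 2 - V x + u x - w x - c <= 0.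
  exact: u_sub phiC1 (@filterE _ (nbhs x) _ _ x_max).
by move: (_ ^+ 2) => q; lra.
Qed.

Lemma supersolution_test :
  viscosity_supersolution
    (fun x r p => quad_hamiltonian V x (P + p) + r - w x - c) u ->
  C1 phi -> u x <= w x -> (forall y, u x - phi x <= u y - phi y) ->
  c + V x <= enorm (P + grad phi x) ^+ 2.
Proof.
move=> u_super phiC1 uw x_min.
have : 0 <= enorm (P + grad phi x) ^+ 2 - V x + u x - w x - c.
  exact: u_super phiC1 (@filterE _ (nbhs x) _ _ x_min).
by move: (_ ^+ 2) => q; lra.
Qed.

End test_functions.

Lemma enorm_sqr (R : realType) (n : nat) (p : 'rV[R]_n) :
  enorm p ^+ 2 = \sum_j p 0 j ^+ 2.
Proof. by rewrite sqr_sqrtr// sumr_ge0// => j _; rewrite sqr_ge0. Qed.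

Lemma enorm_sqr_tail (R : realType) (n : nat) (P : 'rV[R]_n.+1) :
  enorm P ^+ 2 = P 0 ord0 ^+ 2 + enorm (tail P) ^+ 2.
Proof.
rewrite !enorm_sqr big_ord_recl; congr (_ + _).
by apply: eq_bigr => j _; rewrite mxE.
Qed.

(** * One-variable profiles with prescribed slope near 1/2 *)

(* For a positive slope p, [p * bend] has slope exactly p on [-1/4, 1/2] and
   takes the same value at both ends of the cell [-1/2, 1/2], where 16 makes the
   quadratic term 16 (1/4)^2 equal to the period.  It need not be periodic:
   outside the cell it only has to exceed its periodic extension
   ([bend_grow]). *)
Definition bend (R : realType) (y : R) : R :=
  y + 16 * Num.max (- y - 1 / 4) 0 ^+ 2.

Definition bend' (R : realType) (y : R) : R :=
  1 - 32 * Num.max (- y - 1 / 4) 0.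

(** The derivative [bend'] is Lipschitz with constant 32, which gives half of it here. *)
Lemma bend_remainder (R : realType) (y h : R) :
  `|bend (y + h) - bend y - bend' y * h| <= 16 * h ^+ 2.
Proof.
rewrite /bend /bend' ler_norml.
by case: (leP (- (y + h) - 1 / 4) 0); case: (leP (- y - 1 / 4) 0) => *; nra.
Qed.

Lemma continuous_bend' (R : realType) : continuous (@bend' R).
Proof.
move=> y; apply: cvgB; first exact: cvg_cst.
apply: cvgM; first exact: cvg_cst.
apply: (@continuous_max _ _ (fun y : R => - y - 1 / 4) (cst 0)).
  by apply: cvgB; [exact: cvgN|exact: cvg_cst].
exact: cst_continuous.
Qed.

(** The value -7 = 1 - 32/4 is reached at the left end of the cell. *)
Lemma bend'_itv (R : realType) (y : R) :
  - (1 / 2) <= y <= 1 / 2 -> -7 <= bend' y <= 1.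
Proof.
by move=> y_half; rewrite /bend'; case: (leP (- y - 1 / 4) 0) => *; lra.
Qed.

Lemma bend'_eq1 (R : realType) (y : R) : - (1 / 4) <= y -> bend' y = 1.
Proof.
by move=> y_ge; rewrite /bend'; case: (leP (- y - 1 / 4) 0) => *; lra.
Qed.

Lemma intr_dichotomy (R : realType) (m : int) :
  [\/ m%:~R = 0 :> R, m%:~R <= -1 :> R | 1 <= m%:~R :> R].
Proof.
have [->|m_neq0] := eqVneq m 0; first exact: Or31.
have [m_ge0|m_lt0] := leP 0 m; [apply: Or33|apply: Or32].
  by rewrite ler1z -gtz0_ge1 lt_neqAle eq_sym m_neq0.
by rewrite -[-1]/((-1)%:~R) ler_int; move: m_lt0; case: (m).
Qed.

(** [bend] is convex with value 1/2 at both ends of the cell, so it is at most 1/2 inside and at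
    least 1/2 outside. A nonzero integer translation leaves the interior of the cell. *)
Lemma bend_grow (R : realType) (y : R) (m : int) :
  - (1 / 2) <= y <= 1 / 2 -> bend y <= bend (y + m%:~R).
Proof.
move=> y_half; have := intr_dichotomy R m.
move: (m%:~R : R) => k; rewrite /bend.
case: (leP (- y - 1 / 4) 0); case: (leP (- (y + k) - 1 / 4) 0) => ? ? [] ?;
  subst; nra.
Qed.
Section bent_profile.
Variables (R : realType) (p : R).

(* At most one of the two terms is nonzero: the positive and negative parts of
   the slope p use mirror images of [bend]. *)
Definition profile (t : R) : R :=
  Num.max p 0 * bend (t - 1 / 2) + Num.max (- p) 0 * bend (1 / 2 - t).

Definition profile' (t : R) : R :=
  Num.max p 0 * bend' (t - 1 / 2) - Num.max (- p) 0 * bend' (1 / 2 - t).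

Lemma is_derive_profile (t : R) : is_derive t 1 profile (profile' t).
Proof.
apply: (@is_derive_quadratic_remainder _ _ _ _
  ((Num.max p 0 + Num.max (- p) 0) * 16)) => h.
(* The mirrored term moves by [- h] when [t] moves by [h]. *)
have := bend_remainder (t - 1 / 2) h; have := bend_remainder (1 / 2 - t) (- h).
rewrite /profile /profile' sqrrN.
have -> : t - 1 / 2 + h = h + t - 1 / 2 by ring.
have -> : 1 / 2 - t - h = 1 / 2 - (h + t) by ring.
set r2 := (X in `|X| <= _ -> _) => r2_le.
set r1 := (X in `|X| <= _ -> _) => r1_le.
have pos q : 0 <= Num.max q 0 :> R by rewrite le_max lexx orbT.
apply: (@le_trans _ _ (`|Num.max p 0 * r1 + Num.max (- p) 0 * r2|)).
  by rewrite le_eqVlt; apply/orP; left; apply/eqP; congr `|_|;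
    rewrite /r1 /r2; ring.
apply: le_trans (ler_normD _ _) _.
rewrite !normrM !(ger0_norm (pos _)) -mulrA mulrDl.
by apply: lerD; apply: ler_wpM2l.
Qed.

Lemma continuous_profile' : continuous profile'.
Proof.
move=> t; apply: cvgB; apply: cvgM; try exact: cvg_cst.
  apply: (@continuous_comp _ _ _ (fun t : R => t - 1 / 2) (@bend' R)).
    by apply: cvgB; last exact: cvg_cst.
  exact: continuous_bend'.
apply: (@continuous_comp _ _ _ (fun t : R => 1 / 2 - t) (@bend' R)).
  by apply: cvgB; first exact: cvg_cst.
exact: continuous_bend'.
Qed.

Lemma profile_grow (t : R) (m : int) :
  0 <= t <= 1 -> profile t <= profile (t + m%:~R).
Proof.
move=> t01; rewrite /profile; apply: lerD; apply: ler_wpM2l.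
- by rewrite le_max lexx orbT.
- by rewrite addrAC; apply: bend_grow; lra.
- by rewrite le_max lexx orbT.
- by rewrite opprD addrA -intrN; apply: bend_grow; lra.
Qed.

Lemma profile'_near_half (t : R) : `|t - 1 / 2| <= 1 / 4 -> profile' t = p.
Proof.
rewrite ler_norml => t_half; rewrite /profile' !bend'_eq1; try lra.
by case: (leP p 0); case: (leP (- p) 0) => *; lra.
Qed.

(** The difference is [p * (1 - b)] for a slope [b] in [-7, 1], hence the factor 64 = 8^2. *)
Lemma profile'_dist (t : R) :
  0 <= t <= 1 -> (p - profile' t) ^+ 2 <= 64 * p ^+ 2.
Proof.
move=> t01; have : -7 <= bend' (t - 1 / 2) <= 1 by apply: bend'_itv; lra.
have : -7 <= bend' (1 / 2 - t) <= 1 by apply: bend'_itv; lra.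
rewrite /profile'; move: (bend' _) (bend' _) => b2 b1 b2_itv b1_itv.
have sqr_le b : -7 <= b <= 1 -> (p * (1 - b)) ^+ 2 <= 64 * p ^+ 2.
  by move=> b_itv; rewrite exprMn mulrC ler_wpM2r ?sqr_ge0//; nra.
have [p_le0|/ltW p_ge0] := leP p 0.
  rewrite max_l ?oppr_ge0//; have := sqr_le _ b2_itv.
  by congr (_ ^+ 2 <= _); ring.
rewrite max_r ?oppr_le0//; have := sqr_le _ b1_itv.
by congr (_ ^+ 2 <= _); ring.
Qed.

End bent_profile.

(** * Squared distance to the line and the parabolic penalty *)

(** The weight [(j != ord0)%:R] keeps the sum over all coordinates, the form of the separable
    penalties. *)
Definition line_dist2 (R : realType) (n : nat) (x : 'rV[R]_n.+1) : R :=
  \sum_j (j != ord0)%:R * (x 0 j - 1 / 2) ^+ 2.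

Lemma line_dist2_ge (R : realType) (n : nat) (x : 'rV[R]_n.+1) j :
  j != ord0 -> (x 0 j - 1 / 2) ^+ 2 <= line_dist2 x.
Proof.
move=> j_neq0; rewrite /line_dist2 (bigD1 j)//= j_neq0 -[leLHS]mul1r lerDl.
by rewrite sumr_ge0// => i _; rewrite mulr_ge0 ?ler0n ?sqr_ge0.
Qed.

Lemma line_dist2_eq0 (R : realType) (n : nat) (x : 'rV[R]_n.+1) :
  line_dist2 x = 0 <-> forall j, j != ord0 -> x 0 j = 1 / 2.
Proof.
split=> [x0 j j_neq0|x_half].
  have := line_dist2_ge x j_neq0; rewrite x0 => sqr_le0.
  by apply/eqP; rewrite -subr_eq0 -sqrf_eq0 eq_le sqr_le0 sqr_ge0.
rewrite /line_dist2 big1// => j _.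
by have [->|/x_half->] := eqVneq j ord0; rewrite ?mul0r// subrr expr0n mulr0.
Qed.

Lemma line_dist2_ge0 (R : realType) (n : nat) (x : 'rV[R]_n.+1) :
  0 <= line_dist2 x.
Proof.
by rewrite sumr_ge0// => j _; rewrite mulr_ge0 ?ler0n ?sqr_ge0.
Qed.

Lemma is_derive_parabola (R : realType) (K t : R) :
  is_derive t 1 (fun t => K * (t - 1 / 2) ^+ 2) (2 * K * (t - 1 / 2)).
Proof.
apply: (@is_derive_quadratic_remainder _ _ _ _ `|K|) => h.
rewrite -(ger0_norm (sqr_ge0 h)) -normrM le_eqVlt; apply/orP; left.
by apply/eqP; congr `|_|; ring.
Qed.

Lemma continuous_parabola (R : realType) (K : R) :
  continuous (fun t : R => K * (t - 1 / 2) ^+ 2).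
Proof.
move=> t; apply: differentiable_continuous; apply/derivable1_diffP.
by have [] := is_derive_parabola K t.
Qed.

Lemma continuous_line_dist2 (R : realType) (n : nat) :
  continuous (@line_dist2 R n).
Proof.
apply: continuous_big => [|j _ x]; first exact: add_continuous.
apply: (@continuous_comp _ _ _ (fun x : 'rV[R]_n.+1 => x 0 j)
  (fun t => (j != ord0)%:R * (t - 1 / 2) ^+ 2)).
  exact: coord_continuous.
exact: continuous_parabola.
Qed.

(** For nonzero [m], the translate of [t] is at distance at least 1/2 from the centre 1/2, while [t]
    is at distance at most 1/2. *)
Lemma parabola_grow (R : realType) (K t : R) (m : int) : 0 <= K ->
  0 <= t <= 1 -> K * (t - 1 / 2) ^+ 2 <= K * (t + m%:~R - 1 / 2) ^+ 2.
Proof.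
move=> K_ge0 t01; apply: ler_wpM2l => //; have := intr_dichotomy R m.
by move: (m%:~R : R) => k [] ?; subst; nra.
Qed.

(** * The two bounds on the effective Hamiltonian *)

Section two_potentials.
Variables (R : realType) (n : nat) (V1 V2 : 'rV[R]_n.+1 -> R).
Hypotheses (V1_cont : torus_continuous V1) (V2_cont : torus_continuous V2).
Hypotheses (V1_ge0 : forall x, 0 <= V1 x) (V2_ge0 : forall x, 0 <= V2 x).

Section fixed_momentum.
Variables (P : 'rV[R]_n.+1) (c : R) (v1 v2 : 'rV[R]_n.+1 -> R).
Hypothesis v_sol :
  cell_solution (quad_hamiltonian V1) (quad_hamiltonian V2) P c v1 v2.

Lemma effective_lower_bound :
  (forall x, unit_cube x -> line_dist2 x = 0 -> V1 x = 0) ->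
  (forall x, unit_cube x -> line_dist2 x = 0 -> V2 x = 0) ->
  P 0 ord0 ^+ 2 <= c.
Proof.
move=> V1_line V2_line; case: v_sol => v1_cont v2_cont [v1_sub _] [v2_sub _].
apply/ler_addgt0Pr => e e_gt0.
have cube_compact := @compact_unit_cube R n.
have dist_cont := @continuous_line_dist2 R n.
have dist_ge0 (x : 'rV[R]_n.+1) : unit_cube x -> 0 <= line_dist2 x.
  by move=> _; exact: line_dist2_ge0.
have [d1 d1_gt0 V1_small] :=
  compact_separation cube_compact dist_cont V1_cont.2 e_gt0 dist_ge0 V1_line.
have [d2 d2_gt0 V2_small] :=
  compact_separation cube_compact dist_cont V2_cont.2 e_gt0 dist_ge0 V2_line.
have [M1 v1_le] := unit_cube_bounded v1_cont.2.
have [M2 v2_le] := unit_cube_bounded v2_cont.2.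
(* [K * d = 2 * M] exceeds the oscillation of each component on the cube, so comparison with a point
   of the line puts the extremum point at squared distance less than [d]. *)
pose M := `|M1| + `|M2| + 1; pose d := Num.min d1 d2; pose K := 2 * M / d.
have d_gt0 : 0 < d by rewrite lt_min d1_gt0.
have M_gt0 : 0 < M by rewrite ltr_wpDl ?addr_ge0.
have K_ge0 : 0 <= K by rewrite divr_ge0 ?mulr_ge0 ?ltW.
pose F (j : 'I_n.+1) t := K * (j != ord0)%:R * (t - 1 / 2) ^+ 2 : R.
pose S (x : 'rV[R]_n.+1) := \sum_j F j (x 0 j).
have SE x : S x = K * line_dist2 x.
  by rewrite mulr_sumr; apply: eq_bigr => j _; rewrite mulrA.
have torus_opp (u : 'rV[R]_n.+1 -> R) : torus_continuous u ->
      torus_continuous (fun x => - u x).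
  move=> [u_per u_cont]; split; first by move=> x z; rewrite u_per.
  by move=> x; apply: continuousN; exact: u_cont.
have F_cont j : continuous (F j) by exact: continuous_parabola.
have F_grow j t (m : int) : 0 <= t <= 1 -> F j t <= F j (t + m%:~R).
  by apply: parabola_grow; rewrite mulr_ge0.
have [|S_C1 S_grad] := @C1_separable R n F _
    (fun j t => is_derive_parabola (K * (j != ord0)%:R) t).
  by move=> j t; apply: cvgM; [exact: cvg_cst|apply: cvgB => //; exact: cvg_cst].
(* The penalty has no slope in the first coordinate; the other coordinates only add squares. *)
have P0_le x : P 0 ord0 ^+ 2 <= enorm (P + grad S x) ^+ 2.
  rewrite enorm_sqr_tail S_grad !mxE /= !mulr0 mul0r addr0 lerDl.
  exact: sqr_ge0.
(* A minimum of [min(-v1, -v2) + S] is a maximum of [max(v1, v2) - S]. *)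
have [x x_cube x_max] := penalized_min_attained (torus_opp _ v1_cont)
  (torus_opp _ v2_cont) F_cont F_grow.
(* The centre of the cube lies on the line, where the penalty vanishes. *)
pose y : 'rV[R]_n.+1 := const_mx (1 / 2).
have y_cube : unit_cube y by move=> j; rewrite mxE; lra.
have Sy0 : S y = 0.
  by rewrite SE (line_dist2_eq0 _).2 ?mulr0// => j _; rewrite mxE.
have dist_small v Mv : (forall x, unit_cube x -> `|v x| <= Mv) -> Mv < M ->
    - v x + S x <= - v y + S y -> line_dist2 x < d.
  move=> v_le Mv_lt; rewrite Sy0 SE => x_le.
  have := v_le _ x_cube; have := v_le _ y_cube; rewrite !ler_norml => vy vx.
  have : K * line_dist2 x < 2 * M by lra.
  by rewrite /K mulrAC ltr_pdivrMr// ltr_pM2l// mulr_gt0.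
case: x_max => -[v_le x_max].
- have x_near : line_dist2 x < d.
    apply: dist_small v1_le _ (x_max y).
    by have := ler_norm M1; have := normr_ge0 M2; rewrite /M; lra.
  have V_lt : V1 x < e.
    by apply: V1_small => //; apply: lt_le_trans x_near _; rewrite ge_min lexx.
  have : enorm (P + grad S x) ^+ 2 <= c + V1 x.
    apply: subsolution_test v1_sub S_C1 _ _; first by rewrite -lerN2.
    by move=> z; have := x_max z; lra.
  by move=> x_test; have := P0_le x; lra.
- have x_near : line_dist2 x < d.
    apply: dist_small v2_le _ (x_max y).
    by have := ler_norm M2; have := normr_ge0 M1; rewrite /M; lra.
  have V_lt : V2 x < e.
    apply: V2_small => //; apply: lt_le_trans x_near _.
    by rewrite ge_min lexx orbT.
  have : enorm (P + grad S x) ^+ 2 <= c + V2 x.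
    apply: subsolution_test v2_sub S_C1 _ _; first by rewrite -lerN2.
    by move=> z; have := x_max z; lra.
  by move=> x_test; have := P0_le x; lra.
Qed.

Lemma effective_upper_bound (d : R) :
  (forall x, unit_cube x -> V1 x < d -> line_dist2 x < 1 / 16) ->
  (forall x, unit_cube x -> V2 x < d -> line_dist2 x < 1 / 16) ->
  64 * enorm (tail P) ^+ 2 <= d -> c <= P 0 ord0 ^+ 2.
Proof.
move=> V1_near V2_near P_small.
case: v_sol => v1_cont v2_cont [_ v1_super] [_ v2_super].
(* Zero slope in the first coordinate leaves [P 0 ord0] unchanged in the test. *)
pose p (j : 'I_n.+1) := if j == ord0 then 0 else P 0 j.
pose F j := profile (p j).
pose S (x : 'rV[R]_n.+1) := \sum_j F j (x 0 j).
have F_cont j : continuous (F j).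
  move=> t; apply: differentiable_continuous; apply/derivable1_diffP.
  by have [] := is_derive_profile (p j) t.
have F_grow j t (m : int) : 0 <= t <= 1 -> F j t <= F j (t + m%:~R).
  exact: profile_grow.
pose phi (x : 'rV[R]_n.+1) := \sum_j - F j (x 0 j).
have phiE x : phi x = - S x by rewrite /phi sumrN.
have [||phi_C1 phi_grad] := @C1_separable R n (fun j t => - F j t)
    (fun j t => - profile' (p j) t).
- by move=> j t; apply: is_deriveN; exact: is_derive_profile.
- by move=> j t; apply: cvgN; exact: continuous_profile'.
have [x x_cube x_min] :=
  penalized_min_attained v1_cont v2_cont F_cont F_grow.
have normE : enorm (P + grad phi x) ^+ 2 = P 0 ord0 ^+ 2 +
    \sum_i (P 0 (lift ord0 i) - profile' (P 0 (lift ord0 i))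
                                         (x 0 (lift ord0 i))) ^+ 2.
  rewrite enorm_sqr phi_grad big_ord_recl !mxE /p eqxx; congr (_ + _).
    by rewrite /profile' oppr0 maxxx !mul0r subrr oppr0 addr0.
  by apply: eq_bigr => i _; rewrite !mxE.
have bound V : (forall x, 0 <= V x) ->
    (forall x, unit_cube x -> V x < d -> line_dist2 x < 1 / 16) ->
    enorm (P + grad phi x) ^+ 2 <= P 0 ord0 ^+ 2 + V x.
  move=> V_ge0 V_near; rewrite normE lerD2l.
  (* If [V x < d], each transverse coordinate is within 1/4 of 1/2, where the profile cancels [P']
     exactly. Otherwise [V x >= d] dominates the error, which is at most [64 |P'|^2]. *)
  have [x_close|x_far] := ltP (V x) d.
    rewrite big1 // => i _.
    have i_neq0 : lift ord0 i != ord0 by rewrite eq_sym neq_lift.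
    rewrite profile'_near_half ?subrr ?expr0n//.
    have := V_near _ x_cube x_close.
    have := line_dist2_ge x i_neq0; rewrite ler_norml.
    by move=> *; nra.
  apply: le_trans x_far; apply: le_trans P_small; rewrite enorm_sqr mulr_sumr.
  by apply: ler_sum => i _; rewrite [X in _ <= _ * X ^+ _]mxE profile'_dist.
case: x_min => -[v_le x_min].
- have : c + V1 x <= enorm (P + grad phi x) ^+ 2.
    apply: supersolution_test v1_super (phi_C1 : C1 phi) v_le _ => z.
    by rewrite !phiE !opprK; exact: x_min.
  by move=> x_test; have := bound V1 V1_ge0 V1_near; lra.
- have : c + V2 x <= enorm (P + grad phi x) ^+ 2.
    apply: supersolution_test v2_super (phi_C1 : C1 phi) v_le _ => z.
    by rewrite !phiE !opprK; exact: x_min.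
  by move=> x_test; have := bound V2 V2_ge0 V2_near; lra.
Qed.

End fixed_momentum.
End two_potentials.

(** * From the zero sets to the choice of [gamma] *)

Lemma zero_set_line_dist2 (R : realType) (n : nat) (V : 'rV[R]_n.+1 -> R)
    (V_zero : [set xi | unit_cube xi /\ V xi = 0] =
       [set xi | unit_cube xi /\ forall j, j != ord0 -> xi 0 j = 1 / 2])
    (x : 'rV[R]_n.+1) :
  unit_cube x -> V x = 0 <-> line_dist2 x = 0.
Proof.
move=> x_cube; rewrite line_dist2_eq0; split => x0.
  suff /= [] : [set xi | unit_cube xi /\
    forall j, j != ord0 -> xi 0 j = 1 / 2] x by [].
  by rewrite -V_zero.
by suff /= [] : [set xi | unit_cube xi /\ V xi = 0] x by []; rewrite V_zero.
Qed.

Theorem theorem4p13 (R : realType) (n : nat)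
    (V1 V2 : 'rV[R]_n.+1 -> R) (Hbar : 'rV[R]_n.+1 -> R)
    (V1_cont : torus_continuous V1) (V2_cont : torus_continuous V2)
    (Hbar_eff : is_effective_hamiltonian
                  (quad_hamiltonian V1) (quad_hamiltonian V2) Hbar)
    (V1_ge0 : forall xi, 0 <= V1 xi) (V2_ge0 : forall xi, 0 <= V2 xi)
    (V1_zero : [set xi | unit_cube xi /\ V1 xi = 0] =
       [set xi | unit_cube xi /\ forall j, j != ord0 -> xi 0 j = 1 / 2])
    (V2_zero : [set xi | unit_cube xi /\ V2 xi = 0] =
       [set xi | unit_cube xi /\ forall j, j != ord0 -> xi 0 j = 1 / 2]) :
  (exists2 gamma : R, 0 < gamma &
     forall P : 'rV[R]_n.+1, enorm (tail P) <= gamma ->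
       Hbar P = `|P 0 ord0| ^+ 2) /\
  (forall P : 'rV[R]_n.+1, `|P 0 ord0| ^+ 2 <= Hbar P).
Proof.
have V1_line := zero_set_line_dist2 V1_zero.
have V2_line := zero_set_line_dist2 V2_zero.
have lower (P : 'rV[R]_n.+1) : `|P 0 ord0| ^+ 2 <= Hbar P.
  have [v1 [v2 v_sol]] := Hbar_eff P; rewrite real_normK ?num_real//.
  apply: (effective_lower_bound V1_cont V2_cont v_sol).
  - by move=> x x_cube /(V1_line x x_cube).
  - by move=> x x_cube /(V2_line x x_cube).
split=> //.
(* 1/16 is the square of the radius 1/4 on which the profiles have their exact slope. *)
have e_gt0 : 0 < 1 / 16 :> R by lra.
have cube_compact := @compact_unit_cube R n.
have [d1 d1_gt0 V1_near] := compact_separation cube_compact V1_cont.2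
  (@continuous_line_dist2 R n) e_gt0 (fun x _ => V1_ge0 x)
  (fun x x_cube => (V1_line x x_cube).1).
have [d2 d2_gt0 V2_near] := compact_separation cube_compact V2_cont.2
  (@continuous_line_dist2 R n) e_gt0 (fun x _ => V2_ge0 x)
  (fun x x_cube => (V2_line x x_cube).1).
pose d := Num.min d1 d2.
have d_gt0 : 0 < d by rewrite lt_min d1_gt0.
(* This choice gives [64 * gamma^2 = d], the smallness that the upper bound requires. *)
exists (Num.sqrt d / 8); first by rewrite divr_gt0// sqrtr_gt0.
move=> P P_small; apply/eqP; rewrite eq_le lower andbT.
have [v1 [v2 v_sol]] := Hbar_eff P; rewrite real_normK ?num_real//.
apply: (@effective_upper_bound _ _ _ _ V1_ge0 V2_ge0 _ _ _ _ v_sol d).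
- by move=> x x_cube; rewrite lt_min => /andP[/(V1_near x x_cube)].
- by move=> x x_cube; rewrite lt_min => /andP[_ /(V2_near x x_cube)].
have : enorm (tail P) ^+ 2 <= (Num.sqrt d / 8) ^+ 2.
  by rewrite ler_sqr ?nnegrE ?sqrtr_ge0// divr_ge0 ?sqrtr_ge0.
by rewrite expr_div_n (sqr_sqrtr (ltW d_gt0)); lra.
Qed.
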